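(* Let $\alpha\ge 1$ and $n\ge 1$ be integers, and let $H$ be the cyclic subgroup of $\mathbb{Z}_\alpha\wr\mathfrak{S}_n$ generated by $1^{1}2^{1}\cdots n^{1}$ (the identity permutation with all colors equal to $1$). Then the $\alpha$-colored Eulerian polynomial $A_n^\alpha(x)$ can be computed over the quotient $(\mathbb{Z}_\alpha\wr\mathfrak{S}_n)/H$: $$A_n^{\alpha}(x)=\sum_{w\in(\mathbb{Z}_\alpha\wr\mathfrak{S}_n)/H}x^{d(w)},$$ where $d$ is the number of colored descents, evaluated on a coset by means of any of its representatives (the value being independent of the representative).
   Context: $\mathbb{Z}_\alpha$ is the cyclic group of order $\alpha$ with elements $0,1,\dots,\alpha-1$, and $\mathfrak{S}_n$ is the symmetric group on $\{1,\dots,n\}$. Elements of the wreath product $\mathbb{Z}_\alpha\wr\mathfrak{S}_n=(\mathbb{Z}_\alpha)^n\ltimes\mathfrak{S}_n$ (colored permutations) are written $w=w_1^{c_1}w_2^{c_2}\cdots w_n^{c_n}$, where $w_1w_2\cdots w_n\in\mathfrak{S}_n$ is in one-line notation and each color $c_i\in\mathbb{Z}_\alpha$. The product is $$w_1^{c_1}\cdots w_n^{c_n}\cdot y_1^{d_1}\cdots y_n^{d_n}=w_{y_1}^{d_1+c_{y_1}}w_{y_2}^{d_2+c_{y_2}}\cdots w_{y_n}^{d_n+c_{y_n}},$$ with exponents taken modulo $\alpha$. For a colored permutation $w=w_1^{c_1}\cdots w_n^{c_n}$, the colored descent set is $$D(w)=\{\,i\in\{1,\dots,n-1\} : c_i\neq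 c_{i+1},\ \text{or } c_i=c_{i+1}\text{ and }w_i>w_{i+1}\,\},$$ and $d(w)=|D(w)|$ is the number of colored descents. For $\beta\in\mathbb{Z}_\alpha$, $\mathbb{Z}_\alpha\wr\mathfrak{S}_n^{\beta}$ denotes the set of colored permutations in $\mathbb{Z}_\alpha\wr\mathfrak{S}_n$ with last color $c_n=\beta$. The $\alpha$-colored Eulerian polynomial is $$A_n^{\alpha}(x)=\sum_{w\in\mathbb{Z}_\alpha\wr\mathfrak{S}_n^{\beta}}x^{d(w)},$$ where by convention $\beta=0$ (the definition of $d$ uses no ordering on the colors). *)

(* Defs.v *)
From HB Require Import structures.
From mathcomp Require Import all_boot all_order all_algebra all_fingroup.

Set Implicit Arguments.
Unset Strict Implicit.
Unset Printing Implicit Defensive.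

Import GRing.Theory.

(* Positions and letters are counted from 0: the letter w_(i+1) is              *)
(* [letter w i] + 1 and its color c_(i+1) is [color w i].                       *)
Record colperm (alpha n : nat) := ColPerm {
  letter : 'S_n;
  color : {ffun 'I_n -> 'I_alpha}
}.

Section Finite.
Variables alpha n : nat.

Definition pair_of_colperm (w : colperm alpha n) :
  'S_n * {ffun 'I_n -> 'I_alpha} := (letter w, color w).

Definition colperm_of_pair (p : 'S_n * {ffun 'I_n -> 'I_alpha}) :=
  ColPerm p.1 p.2.

Lemma pair_of_colpermK : cancel pair_of_colperm colperm_of_pair.
Proof. by case. Qed.

HB.instance Definition _ :=
  Finite.copy (colperm alpha n) (can_type pair_of_colpermK).

End Finite.

(* The group structure needs Z_alpha = 'I_alpha to be a zmodType, so alpha has  *)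
(* the form a.+1; unlike 'Z_alpha, this also covers alpha = 1.                  *)
Section Wreath.
Variables a n : nat.
Implicit Types w y : colperm a.+1 n.

Definition colperm_one : colperm a.+1 n := ColPerm 1%g [ffun=> 0%R].

(* The i-th letter of w.y is w_(y_i): permutations compose as functions, which  *)
(* is the reverse of the product of 'S_n.                                       *)
Definition colperm_mul w y : colperm a.+1 n :=
  ColPerm (letter y * letter w)%g
    [ffun i => (color y i + color w (letter y i))%R].

Definition colperm_inv w : colperm a.+1 n :=
  ColPerm (letter w)^-1%g [ffun i => (- color w ((letter w)^-1%g i))%R].

Lemma colperm_mulA : associative colperm_mul.
Proof.
move=> u w y; rewrite /colperm_mul; congr ColPerm; first by rewrite /= mulgA.
by apply/ffunP=> i; rewrite /= !ffunE permM addrA.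
Qed.

Lemma colperm_mul1 : left_id colperm_one colperm_mul.
Proof.
case=> s c; rewrite /colperm_mul; congr ColPerm; first by rewrite /= mulg1.
by apply/ffunP=> i; rewrite /= !ffunE addr0.
Qed.

Lemma colperm_mulV : left_inverse colperm_one colperm_inv colperm_mul.
Proof.
case=> s c; rewrite /colperm_mul; congr ColPerm; first by rewrite /= mulgV.
by apply/ffunP=> i; rewrite /= !ffunE permK subrr.
Qed.

HB.instance Definition _ := Finite_isGroup.Build (colperm a.+1 n)
  colperm_mulA colperm_mul1 colperm_mulV.

(* The colored permutation 1^1 2^1 ... n^1; [inZp 1] is 1 modulo a.+1.          *)
Definition colshift : colperm a.+1 n := ColPerm 1%g [ffun=> inZp 1].

Lemma colshift_commute w : commute colshift w.
Proof.
case: w => s c; rewrite /colperm_mul; congr ColPerm; first by rewrite /= mulg1 mul1g.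
by apply/ffunP=> i; rewrite /= !ffunE perm1 addrC.
Qed.

(* In general [G / K] denotes 'N_G(K) K / K; here it is the full quotient.      *)
Lemma colshift_normal : (<[colshift]> <| [set: colperm a.+1 n])%g.
Proof.
apply/andP; split; first exact: subsetT.
apply: cents_norm; rewrite cent_cycle; apply/subsetP=> w _; apply/cent1P.
exact/commute_sym/colshift_commute.
Qed.

End Wreath.

(* [i : 'I_n] stands for the pair of adjacent positions (i, i+1) in 'I_n.+1.    *)
Definition coldes (alpha n : nat) (w : colperm alpha n.+1) : {set 'I_n} :=
  [set i : 'I_n |
    let j : 'I_n.+1 := widen_ord (leqnSn n) i in
    let k : 'I_n.+1 := lift ord0 i in
    (color w j != color w k)
    || (color w j == color w k) && (letter w k < letter w j)].

Definition ndes (alpha n : nat) (w : colperm alpha n.+1) : nat := #|coldes w|.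

Definition last_color (alpha n : nat) (b : 'I_alpha) :
  {set colperm alpha n.+1} := [set w | color w ord_max == b].

(* This is A_(n+1)^(a+1), with the last color taken to be 0.                    *)
Definition col_eulerian (a n : nat) : {poly int} :=
  (\sum_(w in last_color n (0 : 'I_a.+1)) 'X^(ndes w))%R.

(* Main.v *)
Require Import Defs.
From mathcomp Require Import all_boot all_order all_algebra all_fingroup.

(** Multiplying on the left by a power of [colshift] adds one constant to all
the colors and leaves the letters alone. The colored descent set only asks
whether adjacent colors agree, and compares letters when they do, so such a
translation preserves it ([ndes_colshiftXM]); hence [ndes] is constant on the
cosets of H = <[colshift]>.

The constants available are all of Z_alpha, which acts freely and transitively
on the possible values of the last color. So each coset contains exactly one
element whose last color is 0: the set [last_color m 0] is a transversal of H
([coset_colshift_inj], [coset_colshift_surj]), and summing over it is summing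
over the quotient. *)

Set Implicit Arguments.
Unset Strict Implicit.
Unset Printing Implicit Defensive.

Import GRing.Theory.

Lemma colshiftXE a n k :
  (colshift a n ^+ k)%g = ColPerm 1%g [ffun=> inZp k].
Proof.
elim: k => [|k IHk].
  by congr ColPerm; apply/ffunP=> i; rewrite !ffunE; apply: val_inj; rewrite /= mod0n.
rewrite expgS {}IHk; congr ColPerm; first by rewrite /= mulg1.
by apply/ffunP=> i; rewrite !ffunE; apply: val_inj; rewrite /= modnDm addn1.
Qed.

Lemma colshiftXM a n k (w : colperm a.+1 n) :
  (colshift a n ^+ k * w)%g
  = ColPerm (letter w) [ffun i => color w i + inZp k]%R.
Proof.
rewrite colshiftXE; congr ColPerm; first by rewrite /= mulg1.
by apply/ffunP=> i; rewrite !ffunE.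
Qed.

Lemma ndes_colshiftXM a m k (w : colperm a.+1 m.+1) :
  ndes (colshift a m.+1 ^+ k * w)%g = ndes w.
Proof.
rewrite colshiftXM /ndes; congr #|pred_of_set _|.
by apply/setP=> i; rewrite !inE /= !ffunE (inj_eq (addIr _)).
Qed.

Lemma in_norm_colshift a n (w : colperm a.+1 n) : w \in 'N(<[colshift a n]>)%g.
Proof. by apply: (subsetP (normal_norm (colshift_normal a n))); rewrite inE. Qed.

Lemma mem_coset_colshift a n (w : colperm a.+1 n) :
  w \in (coset <[colshift a n]> w : {set _}).
Proof. by rewrite val_coset ?rcoset_refl ?in_norm_colshift. Qed.

(** The form in which coset membership is used: the quotient by H identifies
exactly the colored permutations that differ by a translation of the colors. *)
Lemma coset_colshiftP a n (C : coset_of <[colshift a n]>)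
    (w w' : colperm a.+1 n) :
  w \in (C : {set _}) -> w' \in (C : {set _}) ->
  exists k, w' = (colshift a n ^+ k * w)%g.
Proof.
move=> Cw; rewrite -(coset_mem Cw) val_coset ?in_norm_colshift //.
by case/rcosetP=> _ /cycleP[k ->] ->; exists k.
Qed.

Lemma ndes_coset a m (C : coset_of <[colshift a m.+1]>)
    (w w' : colperm a.+1 m.+1) :
  w \in (C : {set _}) -> w' \in (C : {set _}) -> ndes w = ndes w'.
Proof.
by move=> Cw Cw'; have [k ->] := coset_colshiftP Cw Cw'; rewrite ndes_colshiftXM.
Qed.

(** A translation fixing the last color is by 0, hence is the identity. *)
Lemma coset_colshift_inj a m (b : 'I_a.+1) :
  {in last_color m b &, injective (coset <[colshift a m.+1]>)}.
Proof.
move=> w w'; rewrite !inE => /eqP wb /eqP w'b eq_ww'.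
have Cw' : w' \in (coset <[colshift a m.+1]> w : {set _}).
  by rewrite eq_ww' mem_coset_colshift.
have [k def_w'] := coset_colshiftP (mem_coset_colshift w) Cw'.
move: w'b; rewrite {}def_w' colshiftXM /= ffunE wb.
rewrite -[RHS]addr0 => /addrI ->; case: w {wb eq_ww' Cw'} => s c /=.
by congr ColPerm; apply/ffunP=> i; rewrite ffunE addr0.
Qed.

(** Translating by b minus the last color brings any representative into
[last_color m b]. *)
Lemma coset_colshift_surj a m (b : 'I_a.+1) :
  (coset <[colshift a m.+1]> @: last_color m b)%g
  = ([set: colperm a.+1 m.+1] / <[colshift a m.+1]>)%g.
Proof.
apply/setP=> C; apply/imsetP/idP=> [[w _ ->]|/morphimP[w Nw _ ->]].
  by rewrite mem_quotient ?inE.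
pose k : 'I_a.+1 := (b - color w ord_max)%R.
exists (colshift a m.+1 ^+ k * w)%g.
  by rewrite inE colshiftXM valZpK /= ffunE addrC subrK.
exact/esym/(coset_kerl _ (mem_cycle _ _)).
Qed.

(* alpha = a.+1 and n = m.+1; H is the subgroup <[colshift a m.+1]> *)
Theorem proposition2p5 (a m : nat) :
  let G := [set: colperm a.+1 m.+1]%G in
  let H := <[colshift a m.+1]>%G in
  (forall (C : coset_of H) (w w' : colperm a.+1 m.+1),
     w \in (C : {set colperm a.+1 m.+1}) ->
     w' \in (C : {set colperm a.+1 m.+1}) ->
     ndes w = ndes w')
  /\
  (forall rep : coset_of H -> colperm a.+1 m.+1,
     (forall C : coset_of H, rep C \in (C : {set colperm a.+1 m.+1})) ->
     col_eulerian a m = (\sum_(C in (G / H)%g) 'X^(ndes (rep C)))%R).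
Proof.
move=> G H; split=> [|rep repP]; first exact: ndes_coset.
rewrite -(coset_colshift_surj m 0%R) big_imset /=; last exact: coset_colshift_inj.
apply: eq_bigr => w _.
by rewrite (ndes_coset (mem_coset_colshift w) (repP (coset H w))).
Qed.
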